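(* For every $n\geq1$, $$2^n\sum_{\sigma\in\mathfrak S_{n+1}}u^{{\rm rda}(\sigma)}\Bigl(-\frac12\Bigr)^{{\rm LRmin}(\sigma)+{\rm RLmin}(\sigma)-2}=\begin{cases}\bigl((1+u)^2-4\bigr)^{\lfloor n/2\rfloor},& n\text{ even},\\ -(1+u)\bigl((1+u)^2-4\bigr)^{\lfloor n/2\rfloor},& n\text{ odd}.\end{cases}$$
   Context: For $\sigma=\sigma_1\cdots\sigma_m\in\mathfrak S_m$: ${\rm rda}(\sigma)$ (right double ascents) is the number of $i$ with $1<i\le m$ and $\sigma_{i-1}<\sigma_i<\sigma_{i+1}$, with the convention $\sigma_{m+1}=+\infty$; ${\rm LRmin}(\sigma)$ is the number of $i$ with $\sigma_j>\sigma_i$ for all $j<i$; ${\rm RLmin}(\sigma)$ is the number of $i$ with $\sigma_j>\sigma_i$ for all $j>i$. *)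

(* Defs.v *)
From HB Require Import structures.
From mathcomp Require Import all_boot all_order all_algebra all_fingroup.
Set Implicit Arguments. Unset Strict Implicit. Unset Printing Implicit Defensive.
Import Order.TTheory GRing.Theory Num.Theory.

(* One-line notation of a permutation s of {0,...,m-1}: the word
   s(0) s(1) ... s(m-1) (values shifted by -1 w.r.t. the paper; harmless,
   all statistics only compare values). Positions are 0-indexed. *)
Definition word m (s : 'S_m) : seq nat := [seq val (s i) | i <- enum 'I_m].

(* right double ascents: 1-indexed i with 1 < i <= m and
   w_{i-1} < w_i < w_{i+1}, with w_{m+1} = +infinity.
   0-indexed: j in [1, m-1], w_(j-1) < w_j and (j = m-1 or w_j < w_(j+1)). *)
Definition rda_w (w : seq nat) : nat :=
  count (fun j => (nth 0 w j.-1 < nth 0 w j)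
                  && ((j.+1 == size w) || (nth 0 w j < nth 0 w j.+1)))
        (iota 1 (size w).-1).

Definition LRmin_w (w : seq nat) : nat :=
  count (fun i => all (fun j => nth 0 w i < nth 0 w j) (iota 0 i))
        (iota 0 (size w)).

Definition RLmin_w (w : seq nat) : nat :=
  count (fun i => all (fun j => nth 0 w i < nth 0 w j)
                      (iota i.+1 (size w - i.+1)))
        (iota 0 (size w)).

Definition rda m (s : 'S_m) := rda_w (word s).
Definition LRmin m (s : 'S_m) := LRmin_w (word s).
Definition RLmin m (s : 'S_m) := RLmin_w (word s).

(* Main.v *)
(* Splitting a permutation at its smallest letter separates the left-to-right
   minima (left part) from the right-to-left minima (right part).  Let L, M, R be
   the exponential generating functions of words, with right double ascents
   counted by u and the minima (LR for L, RL for R, none for M) by x, for the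
   boundary conventions (+oo, -oo), (-oo, -oo) and (-oo, +oo) respectively.
   Splitting again gives
     L' = x L M,   R' = x R (M + u - 1),   M' = M^2 + (u - 1) M + (1 - u),
   and G = L R is the generating function to be computed.  For x = -1/2 and
   c = (1 - u)/2 this yields G' = (c - M) G, and the Riccati equation for M makes
   M disappear from G'' = (c^2 - 2c) G, i.e. 4 G'' = ((1 + u)^2 - 4) G.

   Instead of power series, functions of the list of letters are used: the
   derivative of a is the family t |-> a (x :: t), and the product of series is
   the shuffle product [sprod].  No standardization of words is then needed. *)
Require Import Defs.
From HB Require Import structures.
From mathcomp Require Import all_boot all_order all_algebra all_fingroup.
From mathcomp Require Import ring.
Import Order.TTheory GRing.Theory Num.Theory.
Local Open Scope ring_scope.

(** * Algebra of the shuffle product *)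

Fixpoint sprod {R : comNzRingType} {T : Type} (a b : seq T -> R) (s : seq T) : R :=
  if s is x :: s' then
    sprod (fun t => a (x :: t)) b s' + sprod a (fun t => b (x :: t)) s'
  else a [::] * b [::].

(** Both factors are evaluated only at subsequences of [s]. This matters because the recurrences
    below hold only for increasing lists, a property inherited by subsequences. *)
Lemma eq_sprod {R : comNzRingType} {T : eqType} (a a' b b' : seq T -> R) s :
  (forall t, subseq t s -> a t = a' t) -> (forall t, subseq t s -> b t = b' t) ->
  sprod a b s = sprod a' b' s.
Proof.
elim: s a a' b b' => [|x s IH] a a' b b' ha hb /=; first by rewrite ha // hb.
have sub t : subseq t s -> subseq t (x :: s).
  by move/subseq_trans; apply; apply: subseq_cons.
by congr (_ + _); apply: IH => t ts; rewrite ?(ha, hb) //;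
  first [exact: sub | rewrite /= eqxx].
Qed.

Lemma sprodC {R : comNzRingType} {T : Type} (a b : seq T -> R) s :
  sprod a b s = sprod b a s.
Proof.
elim: s a b => [|x s IH] a b /=; first by rewrite mulrC.
by rewrite addrC !(IH _ b) !(IH _ (fun=> b _)).
Qed.

Lemma sprod_linear {R : comNzRingType} {T : Type} (k l : R) (a b c : seq T -> R) s :
  sprod a (fun t => k * b t + l * c t) s = k * sprod a b s + l * sprod a c s.
Proof.
elim: s a b c => [|x s IH] a b c /=; first by ring.
by rewrite !IH; ring.
Qed.

Lemma sprodD {R : comNzRingType} {T : Type} (a b c : seq T -> R) s :
  sprod a (fun t => b t + c t) s = sprod a b s + sprod a c s.
Proof.
elim: s a b c => [|x s IH] a b c /=; first by ring.
by rewrite !IH; ring.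
Qed.

Lemma sprodA {R : comNzRingType} {T : Type} (a b c : seq T -> R) s :
  sprod a (sprod b c) s = sprod (sprod a b) c s.
Proof.
elim: s a b c => [|x s IH] a b c /=; first by rewrite mulrA.
rewrite [sprod a (fun _ => _) s]sprodD !IH.
by rewrite [X in _ = X + _]sprodC sprodD !(sprodC c) addrA.
Qed.

(** The unit of the shuffle product, i.e. the constant series 1. *)
Definition nil_ind {R : comNzRingType} {T : Type} (s : seq T) : R := (nilp s)%:R.

Lemma sprod_nil_ind {R : comNzRingType} {T : Type} (a : seq T -> R) s :
  sprod a nil_ind s = a s.
Proof.
have z (b : seq T -> R) t : sprod b (fun=> 0) t = 0.
  by elim: t b => [|x t IH] b /=; rewrite ?mulr0 // !IH addr0.
elim: s a => [|x s IH] a /=; first by rewrite mulr1.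
by rewrite IH [X in _ + X]z addr0.
Qed.

(** * Sums over arrangements and the splitting rule *)

(* Sum of [F] over all insertions of the letter [x] into [w]. *)
Fixpoint insum {R : comNzRingType} {T : Type} (x : T)
    (F : seq T -> R) (w : seq T) : R :=
  if w is y :: w' then F (x :: w) + insum x (fun v => F (y :: v)) w' else F [:: x].

(* Sum of [F] over all arrangements of [s], built by successive insertions. *)
Fixpoint wordsum {R : comNzRingType} {T : Type} (F : seq T -> R) (s : seq T) : R :=
  if s is x :: s' then wordsum (insum x F) s' else F [::].

(* Sum of [f w1 * g w2] over all factorizations [w = w1 ++ w2]. *)
Fixpoint wconv {R : comNzRingType} {T : Type} (f g : seq T -> R) (w : seq T) : R :=
  if w is y :: w' then f [::] * g w + wconv (fun v => f (y :: v)) g w'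
  else f [::] * g [::].

Lemma eq_insum {R : comNzRingType} {T : eqType} (x : T) (F G : seq T -> R) w :
  (forall v, perm_eq v (x :: w) -> F v = G v) -> insum x F w = insum x G w.
Proof.
elim: w F G => [|y w IH] F G h /=; first exact: h.
congr (_ + _); first exact: h.
apply: IH => v vw; apply: h.
rewrite -[_ :: y :: w]/([:: x] ++ [:: y] ++ w).
by rewrite perm_sym perm_catCA perm_sym perm_cons.
Qed.

Lemma eq_wordsum {R : comNzRingType} {T : eqType} (F G : seq T -> R) s :
  (forall w, perm_eq w s -> F w = G w) -> wordsum F s = wordsum G s.
Proof.
elim: s F G => [|x s IH] F G h /=; first exact: h.
apply: IH => w ws; apply: eq_insum => v vw; apply: h.
by rewrite (perm_trans vw) // perm_cons.
Qed.

Lemma insum_linear {R : comNzRingType} {T : Type} (k l : R) x (F G : seq T -> R) w :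
  insum x (fun v => k * F v + l * G v) w = k * insum x F w + l * insum x G w.
Proof. by elim: w F G => [|y w IH] F G //=; rewrite IH; ring. Qed.

Lemma wordsum_linear {R : comNzRingType} {T : eqType} (k l : R) (F G : seq T -> R) s :
  wordsum (fun v => k * F v + l * G v) s = k * wordsum F s + l * wordsum G s.
Proof.
elim: s F G => [|x s IH] F G //=; rewrite -IH; apply: eq_wordsum => w _.
exact: insum_linear.
Qed.

Lemma wordsum_nil_ind {R : comNzRingType} {T : eqType} (s : seq T) :
  wordsum nil_ind s = nil_ind s :> R.
Proof.
have iz x w : insum x (fun _ : seq T => 0) w = 0 :> R.
  by elim: w => [|y w IH] //=; rewrite IH addr0.
have z (t : seq T) : wordsum (fun=> 0) t = 0 :> R.
  by elim: t => [|x t IH] //=; rewrite (@eq_wordsum _ _ _ (fun=> 0)) // => w _.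
case: s => [|x s] //=; rewrite (@eq_wordsum _ _ _ (fun=> 0)) ?z // => -[|y w] _ //=.
rewrite [X in X + _](_ : _ = 0) // add0r; exact: iz.
Qed.

Lemma wconvDl {R : comNzRingType} {T : Type} (f f' g : seq T -> R) w :
  wconv (fun v => f v + f' v) g w = wconv f g w + wconv f' g w.
Proof. by elim: w f f' => [|y w IH] f f' /=; rewrite ?IH; ring. Qed.

Lemma insum_scaleD {R : comNzRingType} {T : Type} (k : R) x (F G : seq T -> R) w :
  insum x (fun v => k * F v + G v) w = k * insum x F w + insum x G w.
Proof. by elim: w F G => [|y w IH] F G //=; rewrite IH; ring. Qed.

(* Inserting a letter is a derivation for concatenation: this is what turns
   [wconv] into the shuffle product after summation over arrangements. *)
Lemma insum_wconv {R : comNzRingType} {T : Type} x (f g : seq T -> R) w :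
  insum x (wconv f g) w = wconv (insum x f) g w + wconv f (insum x g) w.
Proof.
elim: w f => [|y w IH] f /=; first by ring.
by rewrite insum_scaleD IH wconvDl; ring.
Qed.

Lemma wordsumD {R : comNzRingType} {T : eqType} (F G : seq T -> R) s :
  wordsum (fun v => F v + G v) s = wordsum F s + wordsum G s.
Proof.
rewrite -[wordsum F s]mul1r -[wordsum G s]mul1r -wordsum_linear.
by apply: eq_wordsum => w _; rewrite !mul1r.
Qed.

Lemma wordsum_wconv {R : comNzRingType} {T : eqType} (f g : seq T -> R) s :
  wordsum (wconv f g) s = sprod (wordsum f) (wordsum g) s.
Proof.
elim: s f g => [|x s IH] f g //=; rewrite -!IH -wordsumD.
by apply: eq_wordsum => w _; rewrite insum_wconv.
Qed.

Lemma insum_wconvE {R : comNzRingType} {T : Type} x (F f g : seq T -> R) w :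
  (forall w1 w2, w1 ++ w2 = w -> F (w1 ++ x :: w2) = f w1 * g w2) ->
  insum x F w = wconv f g w.
Proof.
elim: w F f => [|y w IH] F f h /=; first by rewrite -(h [::] [::]).
rewrite -(h [::]) //; congr (_ + _); apply: IH => w1 w2 e.
by rewrite -(h (y :: w1)) //= e.
Qed.

(** The head letter [m] is inserted last, so its possible places in an arrangement [w] of [s] are
    the factorizations of [w]. This turns [insum] into [wconv], hence into a shuffle product. *)
Lemma wordsum_min {R : comNzRingType} (F f g : seq nat -> R) m s :
  (forall w1 w2, all (ltn m) w1 -> all (ltn m) w2 ->
    F (w1 ++ m :: w2) = f w1 * g w2) ->
  path ltn m s ->
  wordsum F (m :: s) = sprod (wordsum f) (wordsum g) s.
Proof.
move=> h /(order_path_min ltn_trans) ms; rewrite -wordsum_wconv /=.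
apply: eq_wordsum => w ws; apply: insum_wconvE => w1 w2 e.
by move: ms; rewrite -(perm_all _ ws) -e all_cat => /andP[]; apply: h.
Qed.

(** * From permutations to arrangements *)

Fixpoint inss {T : Type} (x : T) (w : seq T) : seq (seq T) :=
  if w is y :: w' then (x :: w) :: [seq y :: v | v <- inss x w'] else [:: [:: x]].

Fixpoint arrangements {T : Type} (s : seq T) : seq (seq T) :=
  if s is x :: s' then flatten [seq inss x w | w <- arrangements s'] else [:: [::]].

Lemma insumE {R : comNzRingType} {T : Type} x (F : seq T -> R) w :
  insum x F w = \sum_(v <- inss x w) F v.
Proof.
by elim: w F => [|y w IH] F /=; rewrite ?big_seq1 // big_cons big_map IH.
Qed.

Lemma wordsumE {R : comNzRingType} {T : Type} (F : seq T -> R) s :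
  wordsum F s = \sum_(w <- arrangements s) F w.
Proof.
elim: s F => [|x s IH] F /=; first by rewrite big_seq1.
by rewrite IH big_flatten big_map; apply: eq_bigr => w _; rewrite insumE.
Qed.

Lemma size_arrangements {T : eqType} (s : seq T) :
  size (arrangements s) = (size s)`!.
Proof.
have si x (w : seq T) : size (inss x w) = (size w).+1.
  by elim: w => //= y w IH; rewrite size_map IH.
have: all (fun w => size w == size s) (arrangements s) /\
  size (arrangements s) = (size s)`!; last by case.
elim: s => //= x s [IH1 IH2]; split.
  apply/allP => v /flatten_mapP[w /(allP IH1)/eqP <-] {IH1 IH2}.
  elim: w v => [|y w IH] v /=; first by rewrite inE => /eqP ->.
  by rewrite inE => /predU1P[-> //|/mapP[v' /IH/eqP h ->]] /=; rewrite h.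
rewrite size_flatten /shape -map_comp factS -IH2.
elim: (arrangements s) IH1 => [|w l IH] /=; first by rewrite muln0.
by case/andP => /eqP h /IH ->; rewrite si h mulnS.
Qed.

Lemma mem_arrangements {T : eqType} (s w : seq T) :
  perm_eq w s -> w \in arrangements s.
Proof.
elim: s w => [|x s IH] w /=; first by move/perm_nilP ->.
move=> ws; have xw : x \in w by rewrite (perm_mem ws) mem_head.
case/splitPr: w / xw ws => w1 w2 ws; apply/flatten_mapP; exists (w1 ++ w2).
  by apply: IH; move: ws; rewrite -[x :: w2]/([:: x] ++ w2) perm_catCA perm_cons.
by elim: w1 {ws} => [|y w1 IHw] /=; [case: w2 => [|? ?]; rewrite inE eqxx
  | rewrite inE map_f ?orbT].
Qed.

(** The words of permutations are pairwise distinct and occur among the arrangements, and both lists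
    have n! entries. Counting thus gives equality up to order, and also that the arrangements are
    distinct. *)
Lemma sum_words {R : comNzRingType} n (F : seq nat -> R) :
  \sum_(s : 'S_n) F (word s) = wordsum F (iota 0 n).
Proof.
rewrite wordsumE -(big_map (@word n) xpredT F) /=; apply: perm_big.
have word_inj : injective (@word n).
  move=> s t /eq_in_map e; apply/permP => i; apply/val_inj/e.
  by rewrite mem_enum.
have U : uniq [seq word s | s <- index_enum {perm 'I_n}].
  by rewrite map_inj_uniq // index_enum_uniq.
have S : {subset [seq word s | s <- index_enum {perm 'I_n}] <= arrangements (iota 0 n)}.
  move=> _ /mapP[s _ ->]; apply: mem_arrangements.
  rewrite -val_enum_ord /word map_comp; apply: perm_map.
  apply: uniq_perm; rewrite ?(map_inj_uniq (@perm_inj _ s)) ?enum_uniq // => i.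
  by rewrite mem_enum -[i](permKV s) map_f ?mem_enum.
have Z : (size (arrangements (iota 0 n)) <=
    size [seq word s | s <- index_enum {perm 'I_n}])%N.
  rewrite size_arrangements size_iota size_map -card_Sn cardT enumT.
  by rewrite /index_enum unlock.
apply: uniq_perm => //; first exact: leq_size_uniq U S Z.
by case: (uniq_min_size U S Z).
Qed.

(** * The statistics under splitting at the smallest letter *)

Definition rises_to (x : nat) (w : seq nat) (e : bool) : bool :=
  if w is y :: _ then (x < y)%N else e.

(* [b] tells whether the letter before the word is -oo (otherwise +oo), or more
   generally below its first letter; [e] whether the letter after it is +oo
   (otherwise -oo). *)
Fixpoint dasc (b : bool) (w : seq nat) (e : bool) : nat :=
  if w is x :: w' then (b && rises_to x w' e) + dasc (rises_to x w' e) w' e else 0.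

Lemma rda_wE w : rda_w w = dasc false w true.
Proof.
case: w => [//|p w] /=; rewrite add0n /rda_w /=.
elim: w p => [//|y w IH] p /=; congr (_ + _).
  by case: w {IH} => [|z w]; rewrite /= ?andbT ?orbF.
rewrite -IH -[2%N]addn1 iotaDl count_map; apply: eq_in_count => -[|i] //.
by rewrite mem_iota.
Qed.

(** The left part is followed by a descent to [m], the right part preceded by an ascent from [m]. As
    all letters of [w1] exceed [m], the letter [m] itself can be a double ascent only if [w1] is
    empty: this is the middle term. *)
Lemma dasc_min b e m w1 w2 : all (ltn m) w1 -> all (ltn m) w2 ->
  dasc b (w1 ++ m :: w2) e =
  (dasc b w1 false + (nilp w1 && b && (~~ nilp w2 || e)) + dasc true w2 e)%N.
Proof.
move=> + m2; elim: w1 b => [|x w1 IH] b /=.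
  move=> _; case: w2 m2 => [|y w2] /=; first by rewrite !addn0.
  by case/andP => /= -> _; rewrite add0n andbT.
case/andP => mx m1; rewrite IH //.
have -> : rises_to x (w1 ++ m :: w2) e = rises_to x w1 false.
  by case: w1 {IH m1} => //=; apply/negbTE; rewrite -leqNgt ltnW.
by case: w1 {IH m1} => [|z w1] /=; rewrite ?andbF !addn0 addnA.
Qed.

Lemma all_iota_nth (p : pred nat) w :
  all (fun j => p (nth 0%N w j)) (iota 0 (size w)) = all p w.
Proof. by rewrite -[in RHS](mkseq_nth 0%N w) all_map. Qed.

Lemma RLmin_w_cons x w : RLmin_w (x :: w) = (all (ltn x) w + RLmin_w w)%N.
Proof.
rewrite /RLmin_w /=; congr (_ + _).
  by rewrite subn1 /= -(addn0 1%N) iotaDl all_map all_iota_nth.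
rewrite -(addn0 1%N) iotaDl count_map; apply: eq_count => i /=.
by rewrite subSS -[(1 + i).+1]/(1 + i.+1)%N iotaDl all_map.
Qed.

Lemma LRmin_w_rcons w x : LRmin_w (rcons w x) = (LRmin_w w + all (ltn x) w)%N.
Proof.
rewrite /LRmin_w size_rcons -addn1 iotaD count_cat /= addn0 add0n.
have nw i : (i < size w)%N -> nth 0%N (rcons w x) i = nth 0%N w i.
  by move=> h; rewrite nth_rcons h.
congr (_ + _).
  apply: eq_in_count => i; rewrite mem_iota => /= iw; apply: eq_in_all => j.
  by rewrite mem_iota => /= ji; rewrite !nw // (ltn_trans ji).
rewrite nth_rcons ltnn eqxx -[in RHS]all_iota_nth; congr nat_of_bool.
by apply: eq_in_all => j; rewrite mem_iota => /= ji; rewrite nw.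
Qed.

Lemma RLmin_w_min m w1 w2 : all (ltn m) w1 -> all (ltn m) w2 ->
  RLmin_w (w1 ++ m :: w2) = (RLmin_w w2).+1.
Proof.
move=> + m2; elim: w1 => [|x w1 IH] /=; first by rewrite RLmin_w_cons m2.
case/andP => mx /IH h; rewrite RLmin_w_cons h all_cat /= (ltnNge x m) (ltnW mx).
by rewrite andbF.
Qed.

Lemma LRmin_w_min m w1 w2 : all (ltn m) w1 -> all (ltn m) w2 ->
  LRmin_w (w1 ++ m :: w2) = (LRmin_w w1).+1.
Proof.
move=> m1; elim/last_ind: w2 => [|w2 x IH].
  by rewrite cats1 LRmin_w_rcons m1 addn1.
rewrite all_rcons -rcons_cons -rcons_cat => /andP[mx /IH h].
rewrite LRmin_w_rcons h all_cat /= (ltnNge x m) (ltnW mx).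
by rewrite andbF addn0.
Qed.

(** * The differential equations and their solution *)

Definition wtL {R : comNzRingType} (u x : R) w :=
  u ^+ dasc false w false * x ^+ LRmin_w w.
Definition wtM {R : comNzRingType} (u : R) w := u ^+ dasc true w false.
Definition wtR {R : comNzRingType} (u x : R) w :=
  u ^+ dasc true w true * x ^+ RLmin_w w.

Lemma wordsum_wtM_cons {R : comNzRingType} (u : R) m s : path ltn m s ->
  wordsum (wtM u) (m :: s) =
  sprod (wordsum (wtM u)) (wordsum (wtM u)) s + (u - 1) * wordsum (wtM u) s
  + (1 - u) * nil_ind s.
Proof.
(* [M (w1 ++ m :: w2)] is a product [Q w1 * M w2] except when both sides are empty;
   the indicator [S] of one-letter words corrects this. *)
move=> ms; pose S (w : seq nat) : R := (size w == 1%N)%:R.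
pose F w := 1 * wtM u w + (u - 1) * S w.
pose Q w := 1 * wtM u w + (u - 1) * nil_ind w.
have -> : wordsum (wtM u) (m :: s) = wordsum F (m :: s) + (1 - u) * wordsum S (m :: s).
  by rewrite wordsum_linear; ring.
congr (_ + _ * _).
  rewrite (@wordsum_min _ F Q (wtM u)) //.
    rewrite sprodC (@eq_sprod _ _ _ (wordsum (wtM u)) _
      (fun t => 1 * wordsum (wtM u) t + (u - 1) * nil_ind t)) //.
      by rewrite sprod_linear sprod_nil_ind mul1r.
    by move=> t _; rewrite wordsum_linear wordsum_nil_ind.
  move=> w1 w2 m1 m2; rewrite /F /Q /S /wtM dasc_min // size_cat /= orbF andbT.
  rewrite addnS eqSS addn_eq0 /nil_ind.
  case: w1 w2 {m1 m2} => [|y1 w1] [|y2 w2]; rewrite /nilp /= ?exprD ?expr0 ?expr1; ring.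
rewrite (@wordsum_min _ S nil_ind nil_ind) //.
  rewrite (@eq_sprod _ _ _ nil_ind _ nil_ind) ?sprod_nil_ind // => t _;
  exact: wordsum_nil_ind.
move=> w1 w2 _ _; rewrite /S /nil_ind size_cat /= addnS eqSS addn_eq0.
by rewrite -natrM mulnb.
Qed.

Lemma wordsum_wtL_cons {R : comNzRingType} (u x : R) m s : path ltn m s ->
  wordsum (wtL u x) (m :: s) = x * sprod (wordsum (wtL u x)) (wordsum (wtM u)) s.
Proof.
move=> ms; rewrite (@wordsum_min _ _ (wtL u x) (fun w => x * wtM u w + 0 * wtM u w)) //.
  rewrite (@eq_sprod _ _ _ (wordsum (wtL u x)) _
    (fun t => x * wordsum (wtM u) t + 0 * wordsum (wtM u) t)) //.
    by rewrite sprod_linear mul0r addr0.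
  by move=> t _; rewrite wordsum_linear.
move=> w1 w2 m1 m2; rewrite /wtL /wtM dasc_min // LRmin_w_min // andbF /= addn0.
by rewrite exprD exprS; ring.
Qed.

(** Before the boundary +oo, [m] is a double ascent exactly when [w1] is empty. The left factor is
    therefore that of [wtM] with the weight of the empty word raised from 1 to [u]. *)
Lemma wordsum_wtR_cons {R : comNzRingType} (u x : R) m s : path ltn m s ->
  wordsum (wtR u x) (m :: s) =
  x * sprod (wordsum (wtR u x)) (wordsum (wtM u)) s + x * (u - 1) * wordsum (wtR u x) s.
Proof.
move=> ms; rewrite (@wordsum_min _ _
  (fun w => x * wtM u w + x * (u - 1) * nil_ind w) (wtR u x)) //.
  rewrite sprodC (@eq_sprod _ _ _ (wordsum (wtR u x)) _
    (fun t => x * wordsum (wtM u) t + x * (u - 1) * nil_ind t)) //.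
    by rewrite sprod_linear sprod_nil_ind.
  by move=> t _; rewrite wordsum_linear wordsum_nil_ind.
move=> w1 w2 m1 m2; rewrite /wtR /wtM dasc_min // RLmin_w_min // andbT orbT andbT.
rewrite /nil_ind; case: w1 {m1} => [|y w1]; rewrite /nilp /= ?exprD ?exprS ?expr0; ring.
Qed.

Definition wtG {R : comNzRingType} (u x : R) :=
  sprod (wordsum (wtL u x)) (wordsum (wtR u x)).

(** The smallest letter contributes one to each count of minima, which cancels the -2. It is never a
    double ascent, the left boundary being +oo. *)
Lemma wordsum_rda {R : comNzRingType} (u x : R) m s : path ltn m s ->
  wordsum (fun w => u ^+ rda_w w * x ^+ (LRmin_w w + RLmin_w w - 2)) (m :: s) =
  wtG u x s.
Proof.
apply: wordsum_min => w1 w2 m1 m2.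
rewrite rda_wE dasc_min // LRmin_w_min // RLmin_w_min // andbF /= addn0.
by rewrite addSn addnS !subSS subn0 /wtL /wtR !exprD; ring.
Qed.

Lemma path_sub {m : nat} {s t} : path ltn m s -> subseq t s -> path ltn m t.
Proof. by move=> ms ts; apply: subseq_path ts ms; apply: ltn_trans. Qed.

Lemma wtG_cons {R : comNzRingType} (u x : R) m s : 2 * x = -1 -> path ltn m s ->
  wtG u x (m :: s) =
  x * (u - 1) * wtG u x s - sprod (wtG u x) (wordsum (wtM u)) s.
Proof.
move=> x2 ms; rewrite {1}/wtG.
set L := wordsum (wtL u x); set S := wordsum (wtR u x); set M := wordsum (wtM u).
change (sprod (fun t => L (m :: t)) S s + sprod L (fun t => S (m :: t)) s =
  x * (u - 1) * wtG u x s - sprod (wtG u x) M s).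
rewrite sprodC.
rewrite (@eq_sprod _ _ S S _ (fun t => x * sprod L M t + 0 * L t)) //; last first.
  by move=> t ts; rewrite mul0r addr0; apply: wordsum_wtL_cons; apply: path_sub ts.
rewrite (@eq_sprod _ _ L L _
  (fun t => x * sprod S M t + x * (u - 1) * S t)) //; last first.
  by move=> t ts; apply: wordsum_wtR_cons; apply: path_sub ts.
rewrite !sprod_linear !sprodA.
rewrite (@eq_sprod _ _ (sprod S L) (wtG u x) M M) //; last by move=> t _; apply: sprodC.
rewrite -/(wtG u x) mul0r addr0.
(* The product rule yields the term in [M] twice, with total coefficient 2x = -1. *)
rewrite addrA -mulrDl addrC -[x + x]mulr2n -mulr_natl x2; ring.
Qed.

Lemma wtG_cons2 {R : comNzRingType} (u x : R) m1 m2 s : 2 * x = -1 ->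
  path ltn m1 (m2 :: s) ->
  4 * wtG u x [:: m1, m2 & s] = ((1 + u) ^+ 2 - 4) * wtG u x s.
Proof.
move=> x2 /[dup] ms1 /= /andP[_ ms].
rewrite wtG_cons // (wtG_cons _ _ _ _ x2 ms).
set M := wordsum (wtM u); set c := x * (u - 1).
change (4 * (c * (c * wtG u x s - sprod (wtG u x) M s) -
  (sprod (fun t => wtG u x (m2 :: t)) M s + sprod (wtG u x) (fun t => M (m2 :: t)) s))
   = ((1 + u) ^+ 2 - 4) * wtG u x s).
rewrite (sprodC (fun t => wtG u x (m2 :: t))) (@eq_sprod _ _ M M _
  (fun t => c * wtG u x t + (-1) * sprod (wtG u x) M t)) //; last first.
  by move=> t ts; rewrite mulN1r; exact: (wtG_cons _ _ _ _ x2 (path_sub ms ts)).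
rewrite (@eq_sprod _ _ (wtG u x) (wtG u x) (fun t => M (m2 :: t))
  (fun t => 1 * (sprod M M t + (u - 1) * M t) + (1 - u) * nil_ind t)) //; last first.
  by move=> t ts; rewrite mul1r; apply: (wordsum_wtM_cons _ _ _ (path_sub ms ts)).
rewrite !sprod_linear sprodD sprod_nil_ind.
rewrite (sprodC M (sprod _ _)) (sprodC M) sprodA.
rewrite (@eq_sprod _ _ _ (wtG u x) (fun t => (u - 1) * M t)
  (fun t => (u - 1) * M t + 0 * M t)) //; last first.
  by move=> t _; rewrite mul0r addr0.
rewrite sprod_linear.
have c2 : 2 * c = 1 - u by rewrite /c mulrA x2; ring.
set A := wtG u x s; set B := sprod (wtG u x) M s; set C := sprod _ M s.
(* The two triple products [C] have cancelled. Grouping [c] as [2 * c] allows substituting [c2]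
   without dividing by 2; the terms in [B] then cancel too. *)
transitivity ((2 * c) ^+ 2 * A - 4 * (2 * c) * B + 4 * (1 - u) * B - 4 * (1 - u) * A).
  ring.
by rewrite c2; ring.
Qed.

(** The second-order equation removes two letters at a time, so lists of length 0 and 1 provide the
    initial values 1 and -(1 + u). *)
Lemma wtG_sorted {R : comNzRingType} (u x : R) s : 2 * x = -1 -> sorted ltn s ->
  2 ^+ size s * wtG u x s =
  (if odd (size s) then - (1 + u) else 1) * ((1 + u) ^+ 2 - 4) ^+ (size s)./2.
Proof.
move=> x2; have [k] := ubnP (size s); elim: k s => // k IH [|m1 [|m2 s]] lk ss.
- by rewrite /wtG /= /wtL /wtR /=; ring.
- rewrite wtG_cons // /wtG /= /wtL /wtR /wtM /= !expr0.
  transitivity (2 * x * (u - 1) - 2); first ring.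
  by rewrite x2; ring.
- have -> : 2 ^+ size [:: m1, m2 & s] * wtG u x [:: m1, m2 & s] =
    2 ^+ size s * (4 * wtG u x [:: m1, m2 & s]) by rewrite /= !exprS; ring.
  rewrite wtG_cons2 // mulrCA IH; last first.
  + by move: ss => /= /andP[_ /path_sorted].
  + by move: lk => /=; rewrite !ltnS => /ltnW.
  by rewrite /= negbK [in RHS](exprS _ (size s)./2) mulrCA.
Qed.

(* Polynomial identity in the indeterminate u = 'X, coefficients in rat. *)
Theorem theorem1p8 (n : nat) : (1 <= n)%N ->
  2%:P ^+ n *
    \sum_(s : 'S_n.+1)
       'X ^+ rda s * ((- (2%:R : rat)^-1) ^+ (LRmin s + RLmin s - 2))%:P
  = (if odd n
     then - (1 + 'X) * ((1 + 'X) ^+ 2 - 4%:P) ^+ n./2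
     else ((1 + 'X) ^+ 2 - 4%:P) ^+ n./2 : {poly rat}).
Proof.
move=> _; set x : {poly rat} := (- (2%:R)^-1)%:P.
have x2 : 2 * x = -1.
  by rewrite /x -[2]/(2%:R) -polyC_natr -polyCM mulrN mulfV // polyCN.
under eq_bigr => s _ do rewrite polyC_exp -/x /rda /LRmin /RLmin.
rewrite (@sum_words _ _ (fun w => 'X ^+ rda_w w * x ^+ (LRmin_w w + RLmin_w w - 2))).
(* Splitting off the letter 0 leaves n letters, matching the factor 2^n. *)
have ss : path ltn 0 (iota 1 n) := iota_ltn_sorted 0 n.+1.
rewrite [iota 0 n.+1]/= wordsum_rda // !polyC_natr.
have := wtG_sorted 'X x _ x2 (path_sorted ss); rewrite size_iota => ->.
by case: ifP; rewrite ?mul1r.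
Qed.
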